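(* Let $\mu>0$ be fixed and let $f\in C([0,1])$. Then $$\left|\mathscr{L}_n(f,x)-f(x)\right|=o(n^{-1})\quad\text{as } n\to+\infty,\ \text{for every } x\in(0,1),$$ if and only if $f$ is a classical solution on $(0,1)$ of the second order differential equation $$f_\mu'(x)+(1+\mu)\,f_\mu''(x)=0.$$
   Context: Fix a real parameter $\mu>0$. Put $\ln_\mu(x):=\ln(1+\mu+x)$ for $x\in[0,1]$, and for $n\in\mathbb{N}$, $n\ge 1$, and $0\le k\le n$ put $p_{n,k}(y):=\binom{n}{k}y^k(1-y)^{n-k}$ and $$a_n(x):=\frac{\ln\left(1+\frac{x}{n(1+\mu)}\right)}{\ln\left(1+\frac{1}{n(1+\mu)}\right)},\qquad x\in[0,1].$$ For a bounded function $f:[0,1]\to\mathbb{R}$, define $$\mathscr{L}_n f(x)=\mathscr{L}_n(f,x):=\ln_\mu(x)\sum_{k=0}^n \frac{f(k/n)}{\ln_\mu(k/n)}\,p_{n,k}(a_n(x)),\qquad x\in[0,1],$$ and $f_\mu(x):=f(x)/\ln_\mu(x)$. The $o(n^{-1})$ condition is pointwise in $x$. ''Classical solution on $(0,1)$'' means that $f$ is twice continuously differentiable on $(0,1)$ and the equation holds at every $x\in(0,1)$. *)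

(* Defs.v *)
From Stdlib Require Import Reals.
From Coquelicot Require Import Coquelicot.
Open Scope R_scope.

Definition ln_mu (mu x : R) : R := ln (1 + mu + x).

(* [Binomial.C] is the binomial coefficient; Coquelicot's own [C] is the type
   of complex numbers. *)
Definition p_basis (n k : nat) (y : R) : R :=
  Binomial.C n k * y ^ k * (1 - y) ^ (n - k).

Definition a_seq (mu : R) (n : nat) (x : R) : R :=
  ln (1 + x / (INR n * (1 + mu))) / ln (1 + 1 / (INR n * (1 + mu))).

(* A function on [0,1] is represented by a total function on R.  Only its values
   on [0,1] matter here: the nodes k/n lie in [0,1].  The value at n = 0 is
   meaningless. *)
Definition L_op (mu : R) (n : nat) (f : R -> R) (x : R) : R :=
  ln_mu mu x *
  sum_f_R0 (fun k => f (INR k / INR n) / ln_mu mu (INR k / INR n)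
                     * p_basis n k (a_seq mu n x)) n.

Definition f_mu (mu : R) (f : R -> R) (x : R) : R := f x / ln_mu mu x.

Definition C2_on_01 (f : R -> R) : Prop :=
  forall x, 0 < x < 1 ->
    ex_derive f x /\ ex_derive_n f 2 x /\ continuous (Derive_n f 2) x.

Definition classical_solution (mu : R) (f : R -> R) : Prop :=
  C2_on_01 f /\
  forall x, 0 < x < 1 ->
    Derive (f_mu mu f) x + (1 + mu) * Derive_n (f_mu mu f) 2 x = 0.

(* Main.v *)
Require Import Defs.
From Stdlib Require Import Reals Lra Lia.
From Coquelicot Require Import Coquelicot.
Open Scope R_scope.

(** With [g = f_mu], the hypothesis says that [B_n g (a_n x) - g x = o(1/n)] for
    the Bernstein operators [B_n], and the solutions of the differential equation
    are the functions [g = A + B e^(-x/(1+mu))].  Since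
    [B_n (e^(ct)) y = (1 + (e^(c/n) - 1) y)^n] exactly, these [g] satisfy the
    estimate by a direct computation.  Conversely, subtract from [g] the solution
    [A + B e^(-x/(1+mu))] with the same values at 0 and 1; the difference [h]
    vanishes at 0 and 1 and still satisfies the estimate.  If [h] were positive
    somewhere, [h + eps * x] would have an interior maximum on [0,1], and
    positivity of [B_n] together with [a_n x - x >= const/n] would contradict the
    estimate there; likewise for [-h].  Hence [h = 0]. *)

(** * Second-order bounds for the logarithm and the exponential *)

Lemma nonneg_of_nonneg_derive (F dF : R -> R) (u : R) :
  0 <= u -> F 0 = 0 ->
  (forall t, 0 <= t -> is_derive F t (dF t)) ->
  (forall t, 0 <= t -> 0 <= dF t) -> 0 <= F u.
Proof.
  intros Hu HF0 HdF HdFpos.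
  destruct (MVT_gen F 0 u dF) as [w [Hw Heq]];
    rewrite ?Rmin_left, ?Rmax_right in * by exact Hu.
  - intros t Ht; apply HdF; lra.
  - intros t Ht; apply continuity_pt_filterlim, (ex_derive_continuous F t).
    exists (dF t); apply HdF; lra.
  - assert (0 <= dF w * (u - 0))
      by (apply Rmult_le_pos; [apply HdFpos|]; lra).
    lra.
Qed.

Lemma ln_1p_taylor2 (u : R) :
  0 <= u -> u - u ^ 2 / 2 <= ln (1 + u) <= u - u ^ 2 / 2 + u ^ 3.
Proof.
  intros Hu; split; apply Rminus_le_0.
  - apply (nonneg_of_nonneg_derive
      (fun t => ln (1 + t) - (t - t ^ 2 / 2)) (fun t => t ^ 2 / (1 + t)));
      [exact Hu | rewrite Rplus_0_r, ln_1; lra | |]; intros t Ht.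
    + auto_derive; [lra | field; lra].
    + apply Rdiv_le_0_compat; nra.
  - apply (nonneg_of_nonneg_derive
      (fun t => t - t ^ 2 / 2 + t ^ 3 - ln (1 + t))
      (fun t => (2 * t ^ 2 + 3 * t ^ 3) / (1 + t)));
      [exact Hu | rewrite Rplus_0_r, ln_1; lra | |]; intros t Ht.
    + auto_derive; [lra | field; lra].
    + assert (0 <= t ^ 3) by (apply pow_le, Ht).
      apply Rdiv_le_0_compat; nra.
Qed.

(** The bounds are integrated one after the other: [exp (- t) >= 1 - t] gives [Hup], which is the
    lower bound rearranged, and [Hup] in turn makes the derivative of the cubic difference
    nonnegative. *)
Lemma exp_opp_taylor2 (u : R) :
  0 <= u -> u - u ^ 2 / 2 <= 1 - exp (- u) <= u - u ^ 2 / 2 + u ^ 3.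
Proof.
  assert (Hlow : forall v, 0 <= v -> v - v ^ 2 / 2 <= 1 - exp (- v) ->
            0 <= 1 - v + 3 * v ^ 2 - exp (- v)) by (intros; nra).
  assert (Hup : forall v, 0 <= v -> exp (- v) <= 1 - v + v ^ 2 / 2).
  { intros v Hv; apply Rminus_le_0.
    apply (nonneg_of_nonneg_derive
      (fun t => 1 - t + t ^ 2 / 2 - exp (- t)) (fun t => exp (- t) - (1 - t)));
      [exact Hv | rewrite Ropp_0, exp_0; lra | |]; intros t Ht.
    - auto_derive; [exact I | field].
    - generalize (exp_ineq1_le (- t)); lra. }
  intros Hu; split; [generalize (Hup u Hu); lra | apply Rminus_le_0].
  apply (nonneg_of_nonneg_derive
    (fun t => t - t ^ 2 / 2 + t ^ 3 - (1 - exp (- t)))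
    (fun t => 1 - t + 3 * t ^ 2 - exp (- t)));
    [exact Hu | rewrite Ropp_0, exp_0; lra | |]; intros t Ht.
  - auto_derive; [exact I | field].
  - generalize (Hup t Ht); nra.
Qed.

(** * Bernstein operators on affine and exponential functions *)

Lemma exp_pow (x : R) (n : nat) : exp x ^ n = exp (INR n * x).
Proof.
  induction n as [|n IH].
  - rewrite Rmult_0_l, exp_0; reflexivity.
  - rewrite S_INR, Rmult_plus_distr_r, exp_plus, <- IH, Rmult_1_l; simpl; ring.
Qed.

Definition bernstein (n : nat) (g : R -> R) (y : R) : R :=
  sum_f_R0 (fun k => g (INR k / INR n) * p_basis n k y) n.

Lemma node_bounds (n k : nat) :
  (0 < n)%nat -> (k <= n)%nat -> 0 <= INR k / INR n <= 1.
Proof.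
  intros Hn Hk.
  apply lt_0_INR in Hn; apply le_INR in Hk.
  split; [apply Rdiv_le_0_compat; [apply pos_INR | exact Hn]|].
  apply Rle_div_l; lra.
Qed.

Lemma bernstein_ext (n : nat) (g h : R -> R) (y : R) :
  (0 < n)%nat -> (forall t, 0 <= t <= 1 -> g t = h t) ->
  bernstein n g y = bernstein n h y.
Proof.
  intros Hn Hgh; apply sum_eq; intros k Hk; f_equal.
  apply Hgh, node_bounds; assumption.
Qed.

Lemma p_basis_ge0 (n k : nat) (y : R) : 0 <= y <= 1 -> 0 <= p_basis n k y.
Proof.
  intros Hy; unfold p_basis, Binomial.C.
  repeat apply Rmult_le_pos; try (apply pow_le; lra); try apply pos_INR.
  apply Rlt_le, Rinv_0_lt_compat, Rmult_lt_0_compat; apply INR_fact_lt_0.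
Qed.

Lemma bernstein_le (n : nat) (g h : R -> R) (y : R) :
  (0 < n)%nat -> 0 <= y <= 1 -> (forall t, 0 <= t <= 1 -> g t <= h t) ->
  bernstein n g y <= bernstein n h y.
Proof.
  intros Hn Hy Hgh; apply sum_Rle; intros k Hk.
  apply Rmult_le_compat_r; [apply p_basis_ge0, Hy|].
  apply Hgh, node_bounds; assumption.
Qed.

Lemma bernstein_lin (n : nat) (a b : R) (g h : R -> R) (y : R) :
  bernstein n (fun t => a * g t + b * h t) y
  = a * bernstein n g y + b * bernstein n h y.
Proof.
  unfold bernstein; rewrite !scal_sum, <- plus_sum.
  apply sum_eq; intros; ring.
Qed.

(** The value of the exponential at k/n is the k-th power of [exp (c / INR n)], so it merges with
    [y ^ k] and the sum is a binomial expansion. *)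
Lemma bernstein_exp (n : nat) (c y : R) :
  (0 < n)%nat ->
  bernstein n (fun t => exp (c * t)) y = (1 + (exp (c / INR n) - 1) * y) ^ n.
Proof.
  intros Hn; apply lt_0_INR in Hn.
  replace (1 + _) with (exp (c / INR n) * y + (1 - y)) by ring.
  rewrite binomial; apply sum_eq; intros k _.
  unfold p_basis; rewrite Rpow_mult_distr.
  replace (exp (c * (INR k / INR n))) with (exp (c / INR n) ^ k); [ring|].
  rewrite exp_pow; f_equal; field; lra.
Qed.

Lemma bernstein_1 (n : nat) (y : R) :
  bernstein n (fun _ => 1) y = 1.
Proof.
  transitivity ((y + (1 - y)) ^ n);
    [|replace (y + (1 - y)) with 1 by ring; apply pow1].
  rewrite binomial; apply sum_eq; intros k _; unfold p_basis; ring.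
Qed.

Lemma bernstein_id (n : nat) (y : R) :
  (0 < n)%nat -> bernstein n (fun t => t) y = y.
Proof.
  intros Hn; destruct n as [|m]; [lia|].
  unfold bernstein; rewrite decomp_sum by lia; simpl Init.Nat.pred.
  (* With n = m + 1, the term k = 0 vanishes and C(m+1,k+1) (k+1)/(m+1) = C(m,k), so a factor y
     comes out of a binomial expansion of degree m. *)
  transitivity (y * (y + (1 - y)) ^ m);
    [|replace (y + (1 - y)) with 1 by ring; rewrite pow1; ring].
  rewrite binomial, scal_sum.
  replace (INR 0 / _ * _) with 0 by (simpl; unfold Rdiv; ring).
  rewrite Rplus_0_l; apply sum_eq; intros k Hk.
  unfold p_basis, Binomial.C; rewrite Nat.sub_succ, !fact_simpl, !mult_INR.
  assert (INR (Factorial.fact k) <> 0 /\ INR (Factorial.fact (m - k)) <> 0) by (split; apply INR_fact_neq_0).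
  assert (INR (S k) <> 0 /\ INR (S m) <> 0) by (split; apply not_0_INR; lia).
  simpl pow; field; tauto.
Qed.

(** * Estimates for powers and for the argument [a_seq] *)

Lemma pow_sub_le (a b : R) (n : nat) :
  0 <= a <= 1 -> 0 <= b <= 1 -> Rabs (a ^ n - b ^ n) <= INR n * Rabs (a - b).
Proof.
  intros Ha Hb; induction n as [|n IH].
  - simpl; rewrite Rminus_diag, Rabs_R0; lra.
  - rewrite S_INR; simpl pow.
    replace (a * a ^ n - b * b ^ n)
      with (a * (a ^ n - b ^ n) + b ^ n * (a - b)) by ring.
    eapply Rle_trans; [apply Rabs_triang|].
    rewrite !Rabs_mult, (Rabs_pos_eq a), (Rabs_pos_eq (b ^ n))
      by (try apply pow_le; lra).
    assert (b ^ n <= 1) by (rewrite <- (pow1 n); apply pow_incr; lra).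
    generalize (Rabs_pos (a - b)) (Rabs_pos (a ^ n - b ^ n)); nra.
Qed.

Lemma a_seq_bounds (mu : R) (n : nat) (x : R) :
  0 < mu -> (0 < n)%nat -> 0 <= x <= 1 -> 0 <= a_seq mu n x <= 1.
Proof.
  intros Hmu Hn Hx; apply lt_0_INR in Hn; unfold a_seq.
  assert (Hp : 0 < INR n * (1 + mu)) by nra.
  assert (H0 : 0 <= x / (INR n * (1 + mu))) by (apply Rdiv_le_0_compat; lra).
  assert (H1 : x / (INR n * (1 + mu)) <= 1 / (INR n * (1 + mu)))
    by (apply Rmult_le_compat_r; [apply Rlt_le, Rinv_0_lt_compat|]; lra).
  assert (H2 : 0 < 1 / (INR n * (1 + mu))) by (apply Rdiv_lt_0_compat; lra).
  assert (H3 : 0 < ln (1 + 1 / (INR n * (1 + mu))))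
    by (rewrite <- ln_1; apply ln_increasing; lra).
  split.
  - apply Rdiv_le_0_compat; [rewrite <- ln_1; apply ln_le; lra | exact H3].
  - apply Rle_div_l; [exact H3|]; rewrite Rmult_1_l; apply ln_le; lra.
Qed.

(** With s = 1/(n(1+mu)), the Taylor bounds make [a_seq mu n x - x] equal to x(1-x)s/2 to leading
    order. Half of this gain is kept; the other half absorbs the cubic remainder x s^3, which is why
    s is assumed at most x(1-x)/4. *)
Lemma a_seq_gt (mu : R) (n : nat) (x : R) :
  0 < mu -> (0 < n)%nat -> 0 < x < 1 ->
  1 / (INR n * (1 + mu)) <= x * (1 - x) / 4 ->
  x * (1 - x) / 4 * (1 / (INR n * (1 + mu))) <= a_seq mu n x - x.
Proof.
  intros Hmu Hn Hx; apply lt_0_INR in Hn; unfold a_seq.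
  assert (Hs : 0 < 1 / (INR n * (1 + mu))) by (apply Rdiv_lt_0_compat; nra).
  replace (x / (INR n * (1 + mu))) with (x * (1 / (INR n * (1 + mu))))
    by (field; nra).
  revert Hs; generalize (1 / (INR n * (1 + mu))); intros s Hs Hsx.
  assert (Hxs : 0 <= x * s) by nra.
  generalize (ln_1p_taylor2 s (Rlt_le _ _ Hs)) (ln_1p_taylor2 (x * s) Hxs).
  intros [Hs1 Hs2] [Hx1 Hx2].
  assert (Hlns : ln (1 + s) <= s) by (generalize (exp_ineq1_le s); intros He;
    rewrite <- (ln_exp s) at 2; apply ln_le; lra).
  assert (Hpos : 0 < ln (1 + s)) by (rewrite <- ln_1; apply ln_increasing; lra).
  apply Rle_minus_r, Rle_div_r; [lra|].
  assert (x * (1 - x) / 4 * s * ln (1 + s) <= x * (1 - x) / 4 * s * s)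
    by (apply Rmult_le_compat_l; nra).
  assert (x * ln (1 + s) <= x * (s - s ^ 2 / 2 + s ^ 3))
    by (apply Rmult_le_compat_l; lra).
  assert (x * s ^ 3 <= x * (1 - x) / 4 * s * s) by
   (assert (x * s <= 1 * (x * (1 - x) / 4)) by (apply Rmult_le_compat; lra);
    replace (x * s ^ 3) with ((x * s) * (s * s)) by ring;
    rewrite (Rmult_assoc (x * (1 - x) / 4)); apply Rmult_le_compat_r; nra).
  nra.
Qed.

(* [1 - exp (- u)] and [ln (1 + u)] have the same second-order Taylor
   polynomial, so the terms of order 2 and 3 cancel in the product difference. *)
Lemma exp_ln_mismatch (s x : R) :
  0 < s <= 1 -> 0 <= x <= 1 ->
  Rabs ((1 + (exp (- s) - 1) * (ln (1 + x * s) / ln (1 + s))) - exp (- (x * s)))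
  <= 8 * s ^ 3.
Proof.
  intros Hs Hx.
  assert (Hxs : 0 <= x * s <= s) by nra.
  generalize (ln_1p_taylor2 s ltac:(lra)) (ln_1p_taylor2 (x * s) ltac:(lra))
    (exp_opp_taylor2 s ltac:(lra)) (exp_opp_taylor2 (x * s) ltac:(lra)).
  intros HLs HLx HEs HEx.
  assert (HL : s / 2 <= ln (1 + s)) by nra.
  set (Ls := ln (1 + s)) in *; set (Lx := ln (1 + x * s)) in *.
  replace (1 + (exp (- s) - 1) * (Lx / Ls) - exp (- (x * s)))
    with (((1 - exp (- (x * s))) * Ls - (1 - exp (- s)) * Lx) / Ls)
    by (field; lra).
  set (Es := 1 - exp (- s)) in *; set (Ex := 1 - exp (- (x * s))) in *.
  assert (Hc : (x * s) ^ 3 <= s ^ 3) by (apply pow_incr; lra).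
  assert (Hc0 : 0 <= (x * s) ^ 3) by (apply pow_le; lra).
  set (P := s - s ^ 2 / 2) in *; set (Q := x * s - (x * s) ^ 2 / 2) in *.
  assert (HP : 0 <= P <= s) by (unfold P; nra).
  assert (HQ : 0 <= Q <= s) by (unfold Q; nra).
  assert (HLsu : Ls <= 2 * s) by nra.
  assert (HEsu : 0 <= Es <= 2 * s) by nra.
  unfold Rdiv; rewrite Rabs_mult, (Rabs_pos_eq (/ Ls))
    by (apply Rlt_le, Rinv_0_lt_compat; lra).
  apply Rle_div_l; [lra|].
  (* The common product [P * Q] is removed from both halves. Each half then lies between 0 and 3
     s^4, which is below 8 s^3 (s/2), hence below 8 s^3 [Ls]. *)
  replace (Ex * Ls - Es * Lx)
    with ((Ex - Q) * Ls + Q * (Ls - P) - (Es * (Lx - Q) + Q * (Es - P))) by ring.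
  assert (Hb : forall a b v, 0 <= a <= s ^ 3 -> 0 <= b <= v -> 0 <= a * b <= s ^ 3 * v).
  { intros a b v Ha Hb; split; [nra|]; apply Rmult_le_compat; lra. }
  generalize (Hb (Ex - Q) Ls (2 * s)) (Hb (Ls - P) Q s) (Hb (Lx - Q) Es (2 * s))
    (Hb (Es - P) Q s); intros H1 H2 H3 H4.
  apply Rle_trans with (8 * s ^ 3 * (s / 2)).
  - apply Rabs_le; lra.
  - apply Rmult_le_compat_l; [assert (0 <= s ^ 3) by (apply pow_le; lra)|]; lra.
Qed.

(** * Sequences that are o(1/n) *)

Definition o_inv (u : nat -> R) : Prop :=
  forall eps, 0 < eps -> eventually (fun n => Rabs (u n) <= eps / INR n).

Lemma eventually_ge_INR (r : R) :
  eventually (fun n => (0 < n)%nat /\ r <= INR n).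
Proof.
  destruct (INR_unbounded r) as [N HN]; exists (S N); intros n Hn.
  split; [lia|]; apply le_INR in Hn; rewrite S_INR in Hn; lra.
Qed.

Lemma o_inv_lin (a b : R) (u v : nat -> R) :
  o_inv u -> o_inv v -> o_inv (fun n => a * u n + b * v n).
Proof.
  intros Hu Hv eps Heps.
  (* The summand 1 keeps the divisor of [eps] positive when a = b = 0. *)
  assert (Ha : 0 < Rabs a + Rabs b + 1)
    by (generalize (Rabs_pos a) (Rabs_pos b); lra).
  set (e := eps / (Rabs a + Rabs b + 1)).
  assert (He : 0 < e) by (apply Rdiv_lt_0_compat; lra).
  generalize (filter_and _ _ (eventually_ge_INR 1)
    (filter_and _ _ (Hu e He) (Hv e He))).
  apply filter_imp; intros n [[_ Hn] [H1 H2]].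
  eapply Rle_trans; [apply Rabs_triang|]; rewrite !Rabs_mult.
  replace (eps / INR n) with ((Rabs a + Rabs b + 1) * (e / INR n))
    by (unfold e; field; lra).
  assert (0 < e / INR n) by (apply Rdiv_lt_0_compat; lra).
  generalize (Rabs_pos a) (Rabs_pos b); nra.
Qed.

Lemma o_inv_ext (u v : nat -> R) :
  eventually (fun n => u n = v n) -> o_inv u -> o_inv v.
Proof.
  intros Huv Hu eps Heps.
  generalize (filter_and _ _ Huv (Hu eps Heps)).
  apply filter_imp; intros n [-> H]; exact H.
Qed.

(** * The estimate for solutions and the maximum principle *)

Definition decay (mu t : R) : R := exp (- / (1 + mu) * t).

(** With s = 1/(n(1+mu)), both terms are n-th powers, of bases within 8 s^3 of each other by
    [exp_ln_mismatch]. Passing to powers of numbers in [0,1] costs a factor n, so the error is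
    O(1/n^2). *)
Lemma bernstein_decay (mu x : R) :
  0 < mu -> 0 <= x <= 1 ->
  o_inv (fun n => bernstein n (decay mu) (a_seq mu n x) - decay mu x).
Proof.
  intros Hmu Hx eps Heps.
  (* The threshold comes from n (8 s^3) n = 8 s (s n)^2 <= 8 s <= eps, using s n <= 1 and 8 <= n
     eps. *)
  generalize (eventually_ge_INR (8 / eps)).
  apply filter_imp; intros n [Hn Hne].
  generalize (a_seq_bounds mu n x Hmu Hn Hx); intros Ha.
  unfold decay; rewrite bernstein_exp by exact Hn.
  assert (Hn1 : 1 <= INR n) by (apply (le_INR 1); lia).
  set (s := 1 / (INR n * (1 + mu))).
  assert (Hs0 : 0 < s) by (apply Rdiv_lt_0_compat; nra).
  assert (Hs : s * INR n <= 1).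
  { unfold s; replace (_ * INR n) with (1 / (1 + mu)) by (field; lra).
    apply Rle_div_l; lra. }
  assert (Hs1 : s <= 1).
  { apply Rle_trans with (s * INR n); [|exact Hs].
    rewrite <- (Rmult_1_r s) at 1; apply Rmult_le_compat_l; lra. }
  replace (- / (1 + mu) / INR n) with (- s) by (unfold s; field; lra).
  replace (exp (- / (1 + mu) * x)) with (exp (- (x * s)) ^ n)
    by (rewrite exp_pow; f_equal; unfold s; field; lra).
  assert (He : forall u, 0 <= u -> 0 <= exp (- u) <= 1).
  { intros u Hu; split; [apply Rlt_le, exp_pos|].
    rewrite <- exp_0; destruct Hu as [Hu | <-]; [|rewrite Ropp_0; lra].
    apply Rlt_le, exp_increasing; lra. }
  assert (Hes := He s ltac:(lra)).
  eapply Rle_trans; [apply pow_sub_le; [nra | apply He; nra]|].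
  assert (Hm : Rabs (1 + (exp (- s) - 1) * a_seq mu n x - exp (- (x * s)))
               <= 8 * s ^ 3).
  { unfold a_seq; fold s.
    replace (x / (INR n * (1 + mu))) with (x * s) by (unfold s; field; lra).
    apply exp_ln_mismatch; [lra | exact Hx]. }
  apply (Rle_div_r _ eps (INR n)); [lra|].
  apply Rmult_le_compat_l with (r := INR n) in Hm; [|lra].
  apply Rmult_le_compat_r with (r := INR n) in Hm; [|lra].
  eapply Rle_trans; [exact Hm|].
  apply Rle_div_l in Hne; [|exact Heps].
  replace (INR n * (8 * s ^ 3) * INR n)
    with (8 * s * ((s * INR n) * (s * INR n))) by ring.
  assert (Hse : 8 * s <= eps).
  { apply Rle_trans with (s * INR n * eps).
    - replace (8 * s) with (s * 8) by ring.
      rewrite Rmult_assoc; apply Rmult_le_compat_l; lra.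
    - rewrite <- (Rmult_1_l eps) at 2; apply Rmult_le_compat_r; lra. }
  assert (0 <= s * INR n) by nra.
  rewrite <- (Rmult_1_r eps); apply Rmult_le_compat; nra.
Qed.

(* The interior maximum [x0] of [h + eps * id] gives
   [h t <= h x0 + eps * (x0 - t)] on all of [0,1]; applying the positive
   operator yields a decrease of exact order [1/n] because [a_n x0 - x0] is
   bounded below by a multiple of [1/n]. *)
Lemma le0_of_bernstein_o (mu : R) (h : R -> R) :
  0 < mu -> (forall x, continuity_pt h x) -> h 0 = 0 -> h 1 = 0 ->
  (forall x, 0 < x < 1 ->
     o_inv (fun n => bernstein n h (a_seq mu n x) - h x)) ->
  forall x, 0 <= x <= 1 -> h x <= 0.
Proof.
  intros Hmu Hh H0 H1 Ho x1 Hx1.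
  apply Rnot_lt_le; intros Hpos.
  (* At [x1] the perturbed function is at least 2e, while at 0 and 1 it equals 0 and e, so its
     maximum is interior. *)
  set (e := h x1 / 2).
  assert (He : 0 < e) by (unfold e; lra).
  destruct (continuity_ab_maj (fun t => h t + e * t) 0 1) as [x0 [Hmax Hx0]];
    [lra | intros; apply (continuity_pt_plus h); [apply Hh | reg] |].
  assert (Hx0' : 0 < x0 < 1).
  { generalize (Hmax x1 Hx1); intros Hm.
    destruct (Req_dec x0 0) as [->|]; [unfold e in *; nra|].
    destruct (Req_dec x0 1) as [->|]; [unfold e in *; nra|]; lra. }
  set (d := x0 * (1 - x0) / 4).
  assert (Hd : 0 < d) by (unfold d; nra).
  (* For large n the drop [e * (a_seq mu n x0 - x0)] is at least q/n, so the estimate with tolerance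
     q/2 is contradicted. *)
  set (q := e * d / (1 + mu)).
  assert (Hq : 0 < q) by (apply Rdiv_lt_0_compat; nra).
  destruct (filter_ex (F := eventually) _ (filter_and _ _ (eventually_ge_INR (1 / d))
    (Ho x0 Hx0' (q / 2) ltac:(lra)))) as [n [[Hn Hnd] Hon]].
  assert (Hn1 : 1 <= INR n) by (apply (le_INR 1); lia).
  assert (Hs : 1 / (INR n * (1 + mu)) <= d).
  { apply Rle_div_l in Hnd; [|lra]; apply Rle_div_l; [nra|].
    assert (0 <= INR n * d * mu) by nra; nra. }
  generalize (a_seq_gt mu n x0 Hmu Hn Hx0' Hs); fold d; intros Ha.
  assert (Hb : bernstein n h (a_seq mu n x0)
               <= (h x0 + e * x0) * 1 + - e * a_seq mu n x0).
  { apply Rle_trans with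
      (bernstein n (fun t => (h x0 + e * x0) * 1 + - e * t) (a_seq mu n x0)).
    - apply bernstein_le; [exact Hn | apply a_seq_bounds; lra || exact Hn |].
      intros t Ht; generalize (Hmax t Ht); lra.
    - rewrite (bernstein_lin n _ _ (fun _ => 1) (fun t => t)).
      rewrite bernstein_1, bernstein_id by exact Hn; apply Rle_refl. }
  assert (Hqn : e * (d * (1 / (INR n * (1 + mu)))) = q / INR n)
    by (unfold q; field; lra).
  assert (0 < q / INR n) by (apply Rdiv_lt_0_compat; lra).
  apply Rabs_le_between in Hon.
  replace (q / 2 / INR n) with (q / INR n / 2) in Hon by (field; lra).
  nra.
Qed.

Lemma bernstein_o_iff (mu : R) (g : R -> R) :
  0 < mu -> (forall x, continuity_pt g x) ->
  (forall x, 0 < x < 1 ->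
     o_inv (fun n => bernstein n g (a_seq mu n x) - g x)) <->
  exists A B, forall x, 0 <= x <= 1 -> g x = A + B * decay mu x.
Proof.
  intros Hmu Hg; split.
  - intros Ho.
    assert (Hdc : forall x, continuity_pt (decay mu) x)
      by (intros; unfold decay; reg).
    assert (Hd0 : decay mu 0 = 1)
      by (unfold decay; rewrite Rmult_0_r; apply exp_0).
    assert (Hd1 : decay mu 1 < 1).
    { apply Rlt_le_trans with (exp 0); [|rewrite exp_0; lra].
      apply exp_increasing.
      assert (0 < / (1 + mu)) by (apply Rinv_0_lt_compat; lra); lra. }
    (* Two-point interpolation: [A + B * decay mu] agrees with [g] at 0 and 1, where [decay mu]
       takes different values. *)
    set (B := (g 0 - g 1) / (1 - decay mu 1)).
    set (A := g 0 - B).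
    (* This is b times g - A - B [decay mu]; b = 1 and b = -1 give the two inequalities from one
       argument. The factors 1 fit the shape of [bernstein_lin]. *)
    set (h := fun b t => b * (1 * g t + - B * decay mu t) + - b * A * 1).
    assert (Hle : forall b x, 0 <= x <= 1 -> h b x <= 0).
    { intros b; apply (le0_of_bernstein_o mu); unfold h.
      - exact Hmu.
      - intros x; repeat first
          [ apply Hg | apply Hdc | apply continuity_pt_const; intros ? ?; reflexivity
          | apply continuity_pt_plus | apply continuity_pt_mult ].
      - rewrite Hd0; unfold A; ring.
      - unfold A, B; field; lra.
      - intros x Hx.
        assert (Hx' : 0 <= x <= 1) by lra.
        refine (o_inv_ext _ _ _ (o_inv_lin b (- b * B) _ _
          (Ho x Hx) (bernstein_decay mu x Hmu Hx'))).
        apply filter_forall; intros n.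
        rewrite (bernstein_lin n b (- b * A)
          (fun t => 1 * g t + - B * decay mu t) (fun _ => 1)).
        rewrite bernstein_lin, bernstein_1; ring. }
    exists A, B; intros x Hx.
    generalize (Hle 1 x Hx) (Hle (-1) x Hx); unfold h; lra.
  - intros [A [B HAB]] x Hx.
    assert (Hx' : 0 <= x <= 1) by lra.
    (* Constants are reproduced exactly, so the error for [g] is B times that for [decay mu]; the
       coefficient 0 reduces the linear combination to this single multiple. *)
    refine (o_inv_ext _ _ _ (o_inv_lin 0 B _ _
      (bernstein_decay mu x Hmu Hx') (bernstein_decay mu x Hmu Hx'))).
    generalize (eventually_ge_INR 0); apply filter_imp; intros n [Hn _].
    rewrite (bernstein_ext n g (fun t => A * 1 + B * decay mu t)), HAB
      by (try (intros; rewrite HAB by assumption; ring); assumption).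
    rewrite (bernstein_lin n A B (fun _ => 1)), bernstein_1; ring.
Qed.

(** * Extension from [0,1] to the line *)

(* Extends functions on [0,1] to continuous functions on the line, since Stdlib's
   extreme value theorem requires two-sided continuity at the endpoints. *)
Definition clamp (x : R) : R := Rmax 0 (Rmin 1 x).

Lemma clamp_bounds (x : R) : 0 <= clamp x <= 1.
Proof.
  split; [apply Rmax_l|].
  apply Rmax_lub; [lra | apply Rmin_l].
Qed.

Lemma clamp_id (x : R) : 0 <= x <= 1 -> clamp x = x.
Proof. intros Hx; unfold clamp; rewrite Rmin_right, Rmax_right; lra. Qed.

Lemma clamp_lipschitz (x y : R) : Rabs (clamp y - clamp x) <= Rabs (y - x).
Proof.
  unfold clamp, Rmax, Rmin, Rabs.
  repeat (destruct Rle_dec || destruct Rcase_abs); lra.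
Qed.

(** Since [clamp] is 1-Lipschitz with values in [0,1], [clamp t] tends to [clamp x] within [0,1],
    which is where [f] is continuous. *)
Lemma continuous_comp_clamp (f : R -> R) (x : R) :
  continuous_on (fun x => 0 <= x <= 1) f ->
  continuous (fun t => f (clamp t)) x.
Proof.
  intros Hf; apply (filterlim_comp _ _ _ clamp f _
    (within (fun t => 0 <= t <= 1) (locally (clamp x)))).
  - intros P [e He]; exists e; intros y Hy; apply He; [|apply clamp_bounds].
    eapply Rle_lt_trans; [apply clamp_lipschitz | exact Hy].
  - apply Hf, clamp_bounds.
Qed.

Lemma ln_mu_pos (mu x : R) : 0 < mu -> 0 <= x -> 0 < ln_mu mu x.
Proof. intros; unfold ln_mu; rewrite <- ln_1; apply ln_increasing; lra. Qed.

Lemma continuity_f_mu_clamp (mu : R) (f : R -> R) (x : R) :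
  0 < mu -> continuous_on (fun x => 0 <= x <= 1) f ->
  continuity_pt (fun t => f_mu mu f (clamp t)) x.
Proof.
  intros Hmu Hf.
  apply (continuity_pt_div (fun t => f (clamp t)) (fun t => ln_mu mu (clamp t))).
  - apply continuity_pt_filterlim, continuous_comp_clamp, Hf.
  - apply continuity_pt_filterlim, (continuous_comp_clamp (ln_mu mu)).
    intros y Hy; eapply filterlim_filter_le_1; [apply filter_le_within|].
    apply (ex_derive_continuous (ln_mu mu)).
    unfold ln_mu; auto_derive; lra.
  - apply Rgt_not_eq, ln_mu_pos; [exact Hmu | apply clamp_bounds].
Qed.

(** * The differential equation on the open interval *)

Lemma locally_01 (x : R) :
  0 < x < 1 -> locally x (fun t => 0 < t < 1).
Proof.
  intros Hx; apply (open_and (fun t => 0 < t) (fun t => t < 1));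
    [apply open_gt | apply open_lt | exact Hx].
Qed.

(** The differential equation speaks of the open interval only, whereas Bernstein sums also use the
    nodes 0 and 1; continuity bridges the gap. *)
Lemma eq_on_open_01 (F G : R -> R) :
  (forall x, continuity_pt F x) -> (forall x, continuity_pt G x) ->
  (forall x, 0 < x < 1 -> F x = G x) -> forall x, 0 <= x <= 1 -> F x = G x.
Proof.
  intros HF HG Heq x Hx.
  destruct (Req_dec (F x) (G x)) as [|Hne]; [assumption | exfalso].
  assert (HD : continuous (fun t => F t - G t) x)
    by (apply continuity_pt_filterlim, (continuity_pt_minus F G); auto).
  assert (Hpos : 0 < Rabs (F x - G x)) by (apply Rabs_pos_lt; lra).
  destruct (proj1 (filterlim_locally _ _) HD (mkposreal _ Hpos)) as [e He].
  assert (Hm : 0 < Rmin e 1) by (apply Rmin_pos; [apply cond_pos | lra]).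
  assert (Hm1 := Rmin_l e 1); assert (Hm2 := Rmin_r e 1).
  (* Moving from x towards 1/2 by a positive fraction enters the open interval even from an
     endpoint, and the displacement is at most e/2. *)
  set (y := x + (1 / 2 - x) * Rmin e 1).
  assert (Hy : 0 < y < 1) by (unfold y; nra).
  assert (Hb : Rabs (F y - G y - (F x - G x)) < Rabs (F x - G x)).
  { apply (He y); change (Rabs (y - x) < e).
    apply Rabs_lt_between; unfold y; nra. }
  rewrite Heq, Rminus_diag, Rminus_0_l, Rabs_Ropp in Hb by exact Hy; lra.
Qed.

(** [Derive] is total, so the equation alone asserts no differentiability; the quotient rule
    supplies it from that of [f], as [ln_mu] is positive. *)
Lemma is_derive_f_mu (mu : R) (f : R -> R) (x : R) :
  0 < mu -> C2_on_01 f -> 0 < x < 1 ->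
  is_derive (f_mu mu f) x (Derive (f_mu mu f) x) /\
  is_derive (Derive (f_mu mu f)) x (Derive_n (f_mu mu f) 2 x).
Proof.
  intros Hmu Hf Hx.
  assert (Hln : forall t, 0 < t < 1 -> 0 < ln (1 + mu + t))
    by (intros t Ht; apply (ln_mu_pos mu t); lra).
  assert (Hd : forall t, 0 < t < 1 -> is_derive (f_mu mu f) t
    ((Derive f t * ln (1 + mu + t) - f t * / (1 + mu + t)) / ln (1 + mu + t) ^ 2)).
  { intros t Ht; specialize (Hln t Ht); destruct (Hf t Ht) as [H1 _].
    unfold f_mu, ln_mu; auto_derive; [repeat split; trivial; lra|].
    change (Derive (fun u => f u) t) with (Derive f t); field; lra. }
  split; apply Derive_correct; [eexists; apply Hd, Hx|].
  eapply ex_derive_ext_loc.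
  - generalize (locally_01 x Hx); apply filter_imp; intros t Ht.
    symmetry; apply is_derive_unique, Hd, Ht.
  - specialize (Hln x Hx); destruct (Hf x Hx) as [H1 [H2 _]].
    change (ex_derive (Derive f) x) in H2.
    auto_derive; repeat split; trivial; try lra.
    nra.
Qed.

(** Two first integrals: for g = [f_mu mu f], both F = g + (1+mu) g' and G = g' e^(x/(1+mu)) are
    constant on (0,1). Eliminating g' leaves g = F - (1+mu) G e^(-x/(1+mu)). *)
Lemma solution_form (mu : R) (f : R -> R) :
  0 < mu -> classical_solution mu f ->
  exists A B, forall x, 0 < x < 1 -> f_mu mu f x = A + B * decay mu x.
Proof.
  intros Hmu [Hf Hode].
  set (g := f_mu mu f) in *; set (g1 := Derive g) in *.
  assert (Hd : forall t, 0 < t < 1 ->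
    is_derive g t (g1 t) /\ is_derive g1 t (- / (1 + mu) * g1 t)).
  { intros t Ht; destruct (is_derive_f_mu mu f t Hmu Hf Ht) as [H1 H2].
    split; [exact H1|].
    replace (- / (1 + mu) * g1 t) with (Derive_n g 2 t); [exact H2|].
    generalize (Hode t Ht); fold g1; intros He.
    apply Rmult_eq_reg_l with (1 + mu); [|lra].
    field_simplify; lra. }
  assert (Hconst : forall F : R -> R,
    (forall t, 0 < t < 1 -> is_derive F t 0) ->
    forall x, 0 < x < 1 -> F x = F (1 / 2)).
  { intros F HF x Hx; destruct (Rtotal_order x (1 / 2)) as [Hlt | [-> | Hgt]].
    - apply (eq_is_derive F); [intros; apply HF; lra | exact Hlt].
    - reflexivity.
    - symmetry; apply (eq_is_derive F); [intros; apply HF; lra | exact Hgt]. }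
  set (F := fun t => g t + (1 + mu) * g1 t).
  set (G := fun t => g1 t * exp (/ (1 + mu) * t)).
  assert (HF : forall x, 0 < x < 1 -> F x = F (1 / 2)).
  { apply Hconst; intros t Ht; destruct (Hd t Ht) as [H1 H2]; unfold F.
    auto_derive; [repeat split; eexists; [exact H1 | exact H2]|].
    change (Derive (fun u => g1 u) t) with (Derive g1 t).
    change (Derive (fun u => g u) t) with (Derive g t).
    rewrite (is_derive_unique _ _ _ H1), (is_derive_unique _ _ _ H2).
    field; lra. }
  assert (HG : forall x, 0 < x < 1 -> G x = G (1 / 2)).
  { apply Hconst; intros t Ht; destruct (Hd t Ht) as [H1 H2]; unfold G.
    auto_derive; [repeat split; eexists; exact H2|].
    change (Derive (fun u => g1 u) t) with (Derive g1 t).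
    rewrite (is_derive_unique _ _ _ H2); ring. }
  exists (F (1 / 2)), (- (1 + mu) * G (1 / 2)); intros x Hx.
  rewrite <- (HF x Hx), <- (HG x Hx); unfold F, G, decay.
  replace (- (1 + mu) * (g1 x * exp (/ (1 + mu) * x)) * exp (- / (1 + mu) * x))
    with (- (1 + mu) * g1 x * (exp (/ (1 + mu) * x) * exp (- / (1 + mu) * x)))
    by ring.
  rewrite <- exp_plus.
  replace (/ (1 + mu) * x + - / (1 + mu) * x) with 0 by ring.
  rewrite exp_0; ring.
Qed.

(** The form is known on (0,1) only, so each derivative is computed for an explicit expression and
    transported by equality near the point. *)
Lemma solution_of_form (mu A B : R) (f : R -> R) :
  0 < mu ->
  (forall x, 0 < x < 1 -> f_mu mu f x = A + B * decay mu x) ->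
  classical_solution mu f.
Proof.
  intros Hmu Hform; split.
  - set (c := - / (1 + mu)).
    set (F := fun t => ln (1 + mu + t) * (A + B * exp (c * t))).
    set (F1 := fun t => / (1 + mu + t) * (A + B * exp (c * t))
                        + ln (1 + mu + t) * (B * c * exp (c * t))).
    set (F2 := fun t => - / (1 + mu + t) ^ 2 * (A + B * exp (c * t))
                        + 2 * / (1 + mu + t) * (B * c * exp (c * t))
                        + ln (1 + mu + t) * (B * c ^ 2 * exp (c * t))).
    assert (H0 : forall t, 0 < t < 1 -> is_derive f t (F1 t)).
    { intros t Ht; apply (is_derive_ext_loc F).
      - generalize (locally_01 t Ht); apply filter_imp; intros u Hu.
        assert (Hl := ln_mu_pos mu u Hmu ltac:(lra)).
        change (@eq R (ln_mu mu u * (A + B * decay mu u)) (f u)).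
        rewrite <- Hform by exact Hu; unfold f_mu; field; lra.
      - unfold F, F1; auto_derive; [lra | ring]. }
    assert (H1 : forall t, 0 < t < 1 -> is_derive (Derive f) t (F2 t)).
    { intros t Ht; apply (is_derive_ext_loc F1).
      - generalize (locally_01 t Ht); apply filter_imp; intros u Hu.
        symmetry; apply is_derive_unique, H0, Hu.
      - unfold F1, F2; auto_derive; [lra | field; lra]. }
    intros x Hx; repeat split; [eexists; apply H0, Hx | eexists; apply H1, Hx |].
    apply (continuous_ext_loc _ F2).
    + generalize (locally_01 x Hx); apply filter_imp; intros u Hu.
      symmetry; apply is_derive_unique, H1, Hu.
    + apply (ex_derive_continuous F2); unfold F2; auto_derive.
      repeat split; trivial; nra.
  - assert (H0 : forall t, 0 < t < 1 ->
      is_derive (f_mu mu f) t (- / (1 + mu) * B * decay mu t)).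
    { intros t Ht; apply (is_derive_ext_loc (fun u => A + B * decay mu u)).
      - generalize (locally_01 t Ht); apply filter_imp; intros u Hu.
        symmetry; apply Hform, Hu.
      - unfold decay; auto_derive; [exact I | ring]. }
    intros x Hx; rewrite (is_derive_unique _ _ _ (H0 x Hx)).
    replace (Derive_n (f_mu mu f) 2 x) with ((/ (1 + mu)) ^ 2 * B * decay mu x);
      [field; lra|].
    symmetry; apply is_derive_unique.
    apply (is_derive_ext_loc (fun t => - / (1 + mu) * B * decay mu t)).
    + generalize (locally_01 x Hx); apply filter_imp; intros u Hu.
      symmetry; apply is_derive_unique, H0, Hu.
    + unfold decay; auto_derive; [exact I | ring].
Qed.

(** * Transfer from [L_op] to Bernstein operators *)

Theorem theorem5p1 (mu : R) (hmu : 0 < mu) (f : R -> R)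
    (hf : continuous_on (fun x => 0 <= x <= 1) f) :
  (forall x, 0 < x < 1 ->
     is_domin eventually (fun n : nat => / INR n)
       (fun n : nat => Rabs (L_op mu n f x - f x)))
  <-> classical_solution mu f.
Proof.
  set (g := fun t => f_mu mu f (clamp t)).
  assert (Hg : forall t, 0 <= t <= 1 -> g t = f_mu mu f t)
    by (intros t Ht; unfold g; rewrite clamp_id by exact Ht; reflexivity).
  assert (Hgc : forall t, continuity_pt g t)
    by (intros t; apply continuity_f_mu_clamp; assumption).
  (* At the nodes [g] equals [f_mu mu f], so the two errors differ by the factor [ln_mu mu x],
     positive and independent of n, which preserves o(1/n). *)
  assert (HL : forall n x, (0 < n)%nat -> 0 < x < 1 ->
    L_op mu n f x - f x
    = ln_mu mu x * (bernstein n g (a_seq mu n x) - g x)).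
  { intros n x Hn Hx; rewrite Hg by lra.
    rewrite (bernstein_ext n g (f_mu mu f)) by assumption.
    assert (Hl := ln_mu_pos mu x hmu ltac:(lra)).
    unfold L_op, bernstein, f_mu; field; lra. }
  transitivity (forall x, 0 < x < 1 ->
    o_inv (fun n => bernstein n g (a_seq mu n x) - g x)).
  - split; intros H x Hx; specialize (H x Hx);
      assert (Hl := ln_mu_pos mu x hmu ltac:(lra)).
    + assert (HoL : o_inv (fun n => L_op mu n f x - f x)).
      { intros eps Heps; generalize (filter_and _ _ (eventually_ge_INR 1)
          (H (mkposreal eps Heps))).
        apply filter_imp; intros n [[_ Hn] Hb].
        (* [is_domin] compares norms, here absolute values; n >= 1 removes the one around
           [/ INR n]. *)
        change (Rabs (Rabs (L_op mu n f x - f x)) <= eps * Rabs (/ INR n)) in Hb.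
        rewrite Rabs_Rabsolu, (Rabs_pos_eq (/ INR n)) in Hb
          by (apply Rlt_le, Rinv_0_lt_compat; lra).
        exact Hb. }
      refine (o_inv_ext _ _ _ (o_inv_lin (/ ln_mu mu x) 0 _ _ HoL HoL)).
      generalize (eventually_ge_INR 1); apply filter_imp; intros n [Hn _].
      rewrite HL by assumption; field; lra.
    + assert (HoL : o_inv (fun n => L_op mu n f x - f x)).
      { refine (o_inv_ext _ _ _ (o_inv_lin (ln_mu mu x) 0 _ _ H H)).
        generalize (eventually_ge_INR 1); apply filter_imp; intros n [Hn _].
        rewrite HL by assumption; ring. }
      intros eps; generalize (filter_and _ _ (eventually_ge_INR 1)
        (HoL eps (cond_pos eps))).
      apply filter_imp; intros n [[_ Hn] Hb].
      change (Rabs (Rabs (L_op mu n f x - f x)) <= eps * Rabs (/ INR n)).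
      rewrite Rabs_Rabsolu, (Rabs_pos_eq (/ INR n))
        by (apply Rlt_le, Rinv_0_lt_compat; lra).
      exact Hb.
  - rewrite (bernstein_o_iff mu g hmu Hgc); split.
    + intros [A [B HAB]]; apply (solution_of_form mu A B); [exact hmu|].
      intros x Hx; rewrite <- Hg, HAB by lra; reflexivity.
    + intros Hsol; destruct (solution_form mu f hmu Hsol) as [A [B HAB]].
      exists A, B; apply (eq_on_open_01 g); [exact Hgc | |].
      * intros x; unfold decay; reg.
      * intros x Hx; rewrite Hg by lra; apply HAB, Hx.
Qed.
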